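(* Let $\epsilon>0$ be a constant. There exists $K=K(\epsilon)$ such that for every integer $k\geq K$ and every $k$-regular graph $G$, $$\chi_d(G)\leq \mathrm{ch}_d(G)\leq \lceil (1+\epsilon)\chi_l(G)\rceil.$$
   Context: All graphs are finite and simple. A dynamic coloring of a graph $G$ is a proper vertex coloring such that every vertex of degree at least $2$ has neighbors of at least two different colors; $\chi_d(G)$ is the smallest number of colors in a dynamic coloring. An $l$-list assignment $L$ assigns to each vertex $v$ a set $L(v)$ of $l$ colors. The list chromatic number $\chi_l(G)$ is the least $l$ such that for every $l$-list assignment $L$ there is a proper coloring $c$ with $c(v)\in L(v)$ for all $v$. The dynamic list chromatic number $\mathrm{ch}_d(G)$ is the least $l$ such that for every $l$-list assignment $L$ there is a dynamic coloring $c$ of $G$ with $c(v)\in L(v)$ for all $v$. *)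

(* Defs.v *)
From HB Require Import structures.
From mathcomp Require Import all_boot all_order all_algebra.
From mathcomp Require Import finmap boolp reals.

Set Implicit Arguments.
Unset Strict Implicit.
Unset Printing Implicit Defensive.

Local Open Scope fset_scope.

Record sgraph := SGraph {
  vertex :> finType;
  adj : rel vertex;
  adj_sym : symmetric adj;
  adj_irrefl : irreflexive adj
}.

Definition degree (G : sgraph) (v : G) : nat := #|[set w | adj v w]|.

Definition regular (G : sgraph) (k : nat) : Prop := forall v : G, degree v = k.

Definition proper_coloring (G : sgraph) (C : Type) (c : G -> C) : Prop :=
  forall u v : G, adj u v -> c u <> c v.

Definition dynamic_coloring (G : sgraph) (C : Type) (c : G -> C) : Prop :=
  proper_coloring c /\
  forall v : G, 2 <= degree v ->
    exists u w : G, [/\ adj v u, adj v w & c u <> c w].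

(* Graphs being finite, no generality is lost by drawing colors from nat. *)
Definition list_assignment (G : sgraph) (l : nat) (L : G -> {fset nat}) : Prop :=
  forall v : G, #|` L v| = l.

Definition dynamic_colorable (G : sgraph) (n : nat) : Prop :=
  exists c : G -> 'I_n, dynamic_coloring c.

Definition choosable (G : sgraph) (l : nat) : Prop :=
  forall L : G -> {fset nat}, list_assignment l L ->
    exists2 c : G -> nat, proper_coloring c & forall v, c v \in L v.

Definition dynamic_choosable (G : sgraph) (l : nat) : Prop :=
  forall L : G -> {fset nat}, list_assignment l L ->
    exists2 c : G -> nat, dynamic_coloring c & forall v, c v \in L v.

Lemma injective_dynamic (G : sgraph) (C : Type) (c : G -> C) :
  injective c -> dynamic_coloring c.
Proof.
move=> c_inj; split=> [u v uv /c_inj eq_uv|v].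
  by rewrite eq_uv adj_irrefl in uv.
case/card_gt1P=> u [w] [+ + /eqP neq_uw].
rewrite !inE => vu vw; exists u, w; split=> //.
by move/c_inj.
Qed.

Lemma injective_choice (G : sgraph) (L : G -> {fset nat}) :
  list_assignment #|G| L ->
  exists2 c : G -> nat, injective c & forall v, c v \in L v.
Proof.
move=> sizeL.
suff [c cL c_inj] : exists2 c : G -> nat, {in enum G, forall v, c v \in L v} &
    {in enum G &, injective c}.
  exists c => [u v|v]; last by rewrite cL ?mem_enum.
  by apply: c_inj; rewrite mem_enum.
have: size (enum G) <= #|G| by rewrite -cardE.
elim: (enum G) => [_|x s IHs /= lt_s]; first by exists (fun=> 0).
have [c cL c_inj] := IHs (ltnW lt_s).
have [xs|xNs] := boolP (x \in s).
  have sE : x :: s =i s by move=> y; rewrite inE; case: eqP => // ->.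
  exists c => [y|y z]; rewrite !sE; first exact: cL.
  exact: c_inj.
pose A := [fset y in map c s].
have /fset0Pn[a] : L x `\` A != fset0.
  rewrite fsetD_eq0; apply: contraL lt_s => /fsubset_leq_card.
  rewrite sizeL -leqNgt => /leq_trans; apply.
  rewrite card_fseq (leq_trans (size_undup _)) // size_map.
  by [].
rewrite in_fsetD in_fset => /andP[aNs aL].
exists (fun y => if y == x then a else c y) => [y|y z]; rewrite !inE.
  by case: eqP => [-> //|_] /=; apply: cL.
case: (eqVneq y x) => [->|_] /=; case: (eqVneq z x) => [->|_] //= ys zs.
- by move=> eq_a; rewrite eq_a map_f in aNs.
- by move=> eq_a; rewrite -eq_a map_f in aNs.
- exact: c_inj.
Qed.

Lemma dynamic_colorable_ex (G : sgraph) :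
  exists n, `[< dynamic_colorable G n >].
Proof.
exists #|G|; apply/asboolP; exists enum_rank.
exact/injective_dynamic/enum_rank_inj.
Qed.

Lemma dynamic_choosable_ex (G : sgraph) :
  exists l, `[< dynamic_choosable G l >].
Proof.
exists #|G|; apply/asboolP => L /injective_choice[c c_inj cL].
by exists c => //; apply: injective_dynamic.
Qed.

Lemma choosable_ex (G : sgraph) : exists l, `[< choosable G l >].
Proof.
have [l /asboolP Gl] := dynamic_choosable_ex G; exists l.
by apply/asboolP => L /Gl[c [c_proper _] cL]; exists c.
Qed.

Definition dynamic_chromatic_number (G : sgraph) : nat :=
  ex_minn (dynamic_colorable_ex G).

Definition list_chromatic_number (G : sgraph) : nat :=
  ex_minn (choosable_ex G).

Definition dynamic_list_chromatic_number (G : sgraph) : nat :=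
  ex_minn (dynamic_choosable_ex G).

(* Main.v *)
(* Write s for the list chromatic number of G and l = ceil((1 + eps) s).
   From each list of size l keep a random sublist of size s, independently over
   the vertices. If no color survives in the sublists of all the neighbors of a
   vertex v, then no coloring from the sublists is constant on the neighborhood
   of v; so if this holds at every v, any proper coloring from the sublists, and
   one exists, is dynamic. The event failing at v has probability at most
   l (s / l) ^ k <= l (1 + eps) ^ - k, and it is independent of all but k ^ 2 of
   the events. As s <= k + 1 (greedy coloring), l is linear in k, and the
   Lovasz local lemma applies once k is large. *)

Require Import Defs.
From HB Require Import structures.
From mathcomp Require Import all_boot all_order all_algebra.
From mathcomp Require Import finmap boolp reals.
From mathcomp Require Import zify ring lra.

Set Implicit Arguments.
Unset Strict Implicit.
Unset Printing Implicit Defensive.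

Import Order.TTheory GRing.Theory Num.Theory.
Local Open Scope ring_scope.

(** * Union bound and symmetric local lemma, by counting *)

Lemma leq_card_bigcup (T : finType) (I : Type) (r : seq I) (P : pred I)
    (F : I -> {set T}) :
  (#|\bigcup_(i <- r | P i) F i| <= \sum_(i <- r | P i) #|F i|)%N.
Proof.
elim/big_ind2: _ => [|U m W p lem lep|//]; first by rewrite cards0.
by apply: leq_trans (leq_card_setU _ _) (leq_add lem lep).
Qed.

Definition avoiding (Omega I : finType) (A : I -> {set Omega}) (S : {set I}) :=
  [set w | [forall (i | i \in S), w \notin A i]].

Lemma avoidingP (Omega I : finType) (A : I -> {set Omega}) (S : {set I}) w :
  reflect (forall i, i \in S -> w \notin A i) (w \in avoiding A S).
Proof. by rewrite inE; apply: forall_inP. Qed.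

Lemma avoiding_sub (Omega I : finType) (A : I -> {set Omega})
    (S T : {set I}) : T \subset S -> avoiding A S \subset avoiding A T.
Proof.
move=> /subsetP sTS; apply/subsetP => w /avoidingP wS.
by apply/avoidingP => i /sTS; apply: wS.
Qed.

Section LocalLemma.
Variables (Omega I : finType) (A : I -> {set Omega}) (D : I -> {set I}).
Variable d : nat.
Hypothesis D_refl : forall i, i \in D i.
Hypothesis card_D : forall i, (#|D i| <= d)%N.
(** Independence of [A i] from events outside [D i], for the uniform probability with denominators
    cleared. *)
Hypothesis indep : forall i (S : {set I}), [disjoint S & D i] ->
  (#|A i :&: avoiding A S| * #|Omega| = #|A i| * #|avoiding A S|)%N.
Hypothesis card_A : forall i, (4 * d * #|A i| <= #|Omega|)%N.
Hypothesis Omega_gt0 : (0 < #|Omega|)%N.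

(* Reads Pr(A i | avoiding S) <= 1 / (2 d). *)
Lemma local_lemma_step (S : {set I}) i : i \notin S ->
  (2 * d * #|A i :&: avoiding A S| <= #|avoiding A S|)%N.
Proof.
have [n leSn] := ubnP #|S|; elim: n S i leSn => // n IHn S i ltSn _.
(* [T] drops the events on which [A i] may depend, so Pr(A i | avoiding T) = Pr(A i); passing from
   [T] back to [S] will cost a factor 2. *)
set T := S :\: D i.
have dT : [disjoint T & D i].
  by rewrite -setI_eq0 /T setDE -setIA [_ :&: D i]setIC setICr setI0.
have leTS : T \subset S by apply: subsetDl.
have avS := avoiding_sub A leTS.
have le1 : (4 * d * #|A i :&: avoiding A S| <= #|avoiding A T|)%N.
  rewrite -(leq_pmul2r Omega_gt0) -mulnA.
  have := leq_mul (card_A i) (leqnn #|avoiding A T|).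
  rewrite -mulnA -indep // [leqRHS]mulnC; apply: leq_trans.
  by rewrite !mulnA leq_mul2r leq_mul2l subset_leq_card ?orbT // setIS.
(* At most [d] events were dropped; by induction each takes at most 1/(2d) of [avoiding A T], so
   together at most half. *)
have le2 : (2 * (\sum_(j in S :&: D i) #|A j :&: avoiding A T|)
            <= #|avoiding A T|)%N.
  have dpos : (0 < d)%N.
    by apply: leq_trans (card_D i); apply/card_gt0P; exists i.
  rewrite -(leq_pmul2l dpos) mulnCA mulnA big_distrr /=.
  apply: (@leq_trans (\sum_(j in S :&: D i) #|avoiding A T|)).
    apply: leq_sum => j; rewrite in_setI => /andP[jS jD].
    apply: IHn; last by rewrite in_setD jD.
    rewrite -ltnS; apply: leq_trans ltSn; rewrite ltnS.
    apply: proper_card; rewrite properE leTS; apply/subsetPn; exists j => //.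
    by rewrite in_setD jD.
  rewrite sum_nat_const leq_mul2r; apply/orP; right.
  by apply: leq_trans (card_D i); rewrite subset_leq_card ?subsetIr.
have le3 : (#|avoiding A T| <= #|avoiding A S|
             + \sum_(j in S :&: D i) #|A j :&: avoiding A T|)%N.
  have sub : avoiding A T \subset avoiding A S
      :|: \bigcup_(j in S :&: D i) (A j :&: avoiding A T).
    apply/subsetP => w wT; rewrite in_setU; case: (boolP (w \in _)) => //= wNS.
    have [j jS wj] : exists2 j, j \in S & w \in A j.
      move: wNS; rewrite inE negb_forall_in => /exists_inP[j jS].
      by rewrite negbK; exists j.
    apply/bigcupP; exists j; rewrite in_setI ?wj // jS /=.
    apply: contraLR wj => jD; move/avoidingP: wT; apply.
    by rewrite in_setD jD.
  apply: leq_trans (subset_leq_card sub) _.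
  apply: leq_trans (leq_card_setU _ _) _; rewrite leq_add2l.
  exact: leq_card_bigcup.
(* At least half of [avoiding A T] survives in [avoiding A S], which turns the 1/(4d) of [le1] into
   1/(2d). *)
lia.
Qed.

(** Indices are added one at a time: each new event removes at most 1/(2d), hence at most half, of a
    nonempty set. *)
Lemma local_lemma : exists w, forall i, w \notin A i.
Proof.
suff: (0 < #|avoiding A [set: I]|)%N.
  by case/card_gt0P=> w /avoidingP wA; exists w => i; apply: wA.
have [n] := ubnP #|[set: I]|; elim: n [set: I] => // n IHn S ltSn.
have [->|[i iS]] := set_0Vmem S.
  apply: leq_trans Omega_gt0 _; rewrite -cardsT; apply: subset_leq_card.
  by apply/subsetP => w _; apply/avoidingP => i; rewrite inE.
have ltS : (#|S :\ i| < n)%N by move: ltSn; rewrite (cardsD1 i) iS.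
have S1 := IHn _ ltS.
have := local_lemma_step (negbT (setD11 i S)).
have dpos : (0 < d)%N by apply: leq_trans (card_D i); apply/card_gt0P; exists i.
have -> : avoiding A S = avoiding A (S :\ i) :\: A i.
  apply/setP => w; rewrite in_setD; apply/avoidingP/andP => [wS|].
    by split; [apply: wS | apply/avoidingP => j /setD1P[_]; apply: wS].
  move=> [wi /avoidingP wS] j jS; have [->//|ji] := eqVneq j i.
  by apply: wS; rewrite in_setD1 ji.
rewrite cardsD [_ :&: A i]setIC; nia.
Qed.

End LocalLemma.

(** * Independence in a product space *)

Section Independence.
Variables (V T : finType).
Implicit Types (X : {set V}) (A B : {set {ffun V -> T}}).

Definition determined_by X A :=
  forall f g : {ffun V -> T}, {in X, f =1 g} -> (f \in A) = (g \in A).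

(* Swapping the coordinates outside X is an involution of pairs of functions
   that exchanges (A :&: B) x setT with A x B. *)
Lemma determined_indep X A B : determined_by X A -> determined_by (~: X) B ->
  (#|A :&: B| * #|{ffun V -> T}| = #|A| * #|B|)%N.
Proof.
move=> detA detB.
pose mix (f g : {ffun V -> T}) := [ffun v => if v \in X then f v else g v].
pose swap (p : {ffun V -> T} * {ffun V -> T}) := (mix p.1 p.2, mix p.2 p.1).
have swapK : involutive swap.
  have mixK f g : mix (mix f g) (mix g f) = f.
    by apply/ffunP => v; rewrite !ffunE; case: (v \in X).
  by case=> f g; rewrite /swap /= !mixK.
rewrite -cardsT -!cardsX -(card_imset _ (can_inj swapK)).
apply: eq_card => p; rewrite -[p in LHS]swapK (mem_imset _ _ (can_inj swapK)).
case: p => f g; rewrite !in_setX in_setT andbT in_setI /=.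
congr andb; [apply: detA | apply: detB] => v vX; rewrite ffunE ?vX //.
by move: vX; rewrite in_setC => /negbTE ->.
Qed.

End Independence.

(** * Sublists cut out by cyclic shifts *)

Lemma card_shift_lt (l s : nat) (i : 'I_l.+1) : (s <= l.+1)%N ->
  #|[set r : 'I_l.+1 | ((r + i)%R < s)%N]| = s.
Proof.
move=> lesl; rewrite -[LHS](card_imset _ (addIr i)).
have -> : [set x + i | x in [set r : 'I_l.+1 | ((r + i)%R < s)%N]]
    = [set widen_ord lesl x | x : 'I_s].
  apply/setP => x; apply/imsetP/imsetP => [[r]|[y _ ->]].
    rewrite inE => lts ->; exists (Ordinal lts) => //; exact/val_inj.
  exists (widen_ord lesl y - i); last by rewrite subrK.
  by rewrite inE subrK /=.
rewrite card_imset ?card_ord // => x y /(congr1 val) /= ?; exact/val_inj.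
Qed.

Section Sublist.
Variables (l s : nat) (L : {fset nat}).
Hypothesis cardL : #|` L| = l.+1.
Hypothesis lesl : (s <= l.+1)%N.

(* A cyclic shift of the first s positions of L: shifts are easier to count than
   all s-subsets, and each color still survives for exactly s of the l+1 values
   of r. *)
Definition sublist (r : 'I_l.+1) : {fset nat} :=
  [fset a in L | ((inord (index a L) + r)%R < s)%N]%fset.

Lemma sublist_sub r a : a \in sublist r -> a \in L.
Proof. by rewrite !inE /= => /andP[]. Qed.

Lemma card_sublist r : #|` sublist r| = s.
Proof.
pose f (i : 'I_l.+1) := nth 0%N L i.
have sizeL : size (L : seq nat) = l.+1 by [].
have f_inj : injective f.
  move=> i j /eqP; rewrite nth_uniq ?sizeL ?ltn_ord ?fset_uniq //.
  by move/eqP/val_inj.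
rewrite -[RHS](card_shift_lt r lesl).
pose J := [set i : 'I_l.+1 | ((i + r)%R < s)%N].
have -> : sublist r = [fset f i | i in J]%fset.
  apply/fsetP => a; rewrite !inE /=; apply/andP/imfsetP => /=.
    case=> aL lts; exists (inord (index a L)); first by rewrite inE.
    by rewrite /f inordK ?nth_index // -sizeL index_mem.
  case=> i; rewrite inE => lts ->; rewrite mem_nth ?sizeL //.
  by rewrite index_uniq ?sizeL ?fset_uniq ?inord_val.
by rewrite card_imfset //= -cardE.
Qed.

(** Now the color is fixed and the shift varies; by commutativity the same count applies. A color
    outside [L] survives for no shift, hence only an inequality. *)
Lemma card_sublist_mem a : (#|[set r | a \in sublist r]| <= s)%N.
Proof.
rewrite -[leqRHS](card_shift_lt (inord (index a L)) lesl).
apply: subset_leq_card; apply/subsetP => r.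
by rewrite !inE /= addnC => /andP[].
Qed.

End Sublist.

(** * Avoiding common colors on neighborhoods *)

Section DynamicFromSublists.
Variables (G : sgraph) (k l s : nat) (L : G -> {fset nat}).
Hypothesis G_reg : regular G k.
Hypothesis L_list : list_assignment l.+1 L.
Hypothesis lesl : (s <= l.+1)%N.
Hypothesis k_gt0 : (0 < k)%N.
Hypothesis large : (4 * k ^ 2 * (l.+1 * s ^ k) <= l.+1 ^ k)%N.

Let N (v : G) : {set G} := [set u | adj v u].

(* A color common to the sublists of all neighbors of v lies in L u for any one
   neighbor u, which leaves at most l+1 candidates in the union bound. *)
Definition common_color (v : G) : {set {ffun G -> 'I_l.+1}} :=
  [set r : {ffun G -> 'I_l.+1} | has
    (fun a => [forall (u | adj v u), a \in sublist s (L u) (r u)])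
    (if [pick u | adj v u] is Some u then L u : seq nat else [::])].

Lemma common_colorP v (r : {ffun G -> 'I_l.+1}) a :
  (forall u, adj v u -> a \in sublist s (L u) (r u)) -> r \in common_color v.
Proof.
move=> ra; rewrite inE; case: pickP => [u vu|no].
  apply/hasP; exists a; first exact: sublist_sub (ra u vu).
  exact/forall_inP.
(* An empty neighborhood would leave no candidates; [k_gt0] rules it out. *)
have := G_reg v; rewrite /degree => kE; move: k_gt0.
rewrite -kE => /card_gt0P[u]; rewrite inE no //.
Qed.

(** Union bound over at most l+1 candidates. For each, the event is a box: at most [s] values at
    each of the [k] neighbors, at most l+1 elsewhere. *)
Lemma card_common_color v :
  (#|common_color v| * l.+1 ^ k <= l.+1 * s ^ k * #|{ffun G -> 'I_l.+1}|)%N.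
Proof.
rewrite /common_color; set C : seq nat := if _ is Some _ then _ else _.
have sizeC : (size C <= l.+1)%N.
  by rewrite /C; case: pickP => // u _; rewrite L_list.
pose E a := [set r : {ffun G -> 'I_l.+1} |
               [forall (u | adj v u), a \in sublist s (L u) (r u)]].
have cardE a : (#|E a| * l.+1 ^ k <= s ^ k * #|{ffun G -> 'I_l.+1}|)%N.
  pose F (u : G) :=
    [pred x : 'I_l.+1 | adj v u ==> (a \in sublist s (L u) x)].
  have -> : #|E a| = #|family F|.
    apply: eq_card => r; rewrite [LHS]inE.
    by apply/forallP/familyP => H u; apply: (H u).
  rewrite card_family foldrE big_map big_enum /= card_ffun card_ord.
  rewrite -(cardC (mem (N v))) [#|mem (N v)|](G_reg v) expnD.
  rewrite mulnCA mulnC leq_mul2l; apply/orP; right.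
  rewrite (bigID (mem (N v))) /=; apply: leq_mul.
    rewrite -(G_reg v) /degree -prod_nat_const.
    apply: leq_prod => u; rewrite inE => vu.
    apply: leq_trans _ (card_sublist_mem (L u) lesl a).
    by apply: subset_leq_card; apply/subsetP => x; rewrite inE unfold_in vu.
  rewrite -prod_nat_const; apply: leq_prod => u _.
  by rewrite -[leqRHS]card_ord max_card.
apply: (@leq_trans (\sum_(a <- C) #|E a| * l.+1 ^ k)).
  rewrite -big_distrl /= leq_mul2r; apply/orP; right.
  apply: (@leq_trans #|\bigcup_(a <- C) E a|).
    apply/subset_leq_card/subsetP => r; rewrite inE => /hasP[a aC ra].
    by rewrite (big_rem a) //= in_setU inE ra.
  exact: leq_card_bigcup.
apply: leq_trans (leq_sum _ (fun a _ => cardE a)) _.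
rewrite big_const_seq count_predT iter_addn_0 mulnC -mulnA leq_mul2r.
by rewrite sizeC orbT.
Qed.

Lemma common_color_determined v : determined_by (N v) (common_color v).
Proof.
move=> f g fg; rewrite !inE; apply: eq_has => a.
by apply: eq_forallb_in => u vu; rewrite fg ?inE.
Qed.

Lemma exists_no_common_color :
  exists r : {ffun G -> 'I_l.+1}, forall v, r \notin common_color v.
Proof.
(* The vertices sharing a neighbor with [v] are the ends of walks of length two, so there are at
   most k^2 of them, [v] included. *)
pose D v : {set G} := [set w | ~~ [disjoint N v & N w]].
apply: (@local_lemma _ _ _ D (k ^ 2)).
- move=> v; rewrite inE -setI_eq0 setIid -card_gt0.
  by have := G_reg v; rewrite /degree => ->.
- move=> v; apply: (@leq_trans #|\bigcup_(u in N v) N u|).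
    apply/subset_leq_card/subsetP => w; rewrite inE => /pred0Pn[u /=].
    rewrite !inE => /andP[vu wu]; apply/bigcupP; exists u; rewrite !inE //.
    by rewrite adj_sym.
  apply: (@leq_trans (\sum_(u in N v) #|N u|)); first exact: leq_card_bigcup.
  rewrite (eq_bigr (fun=> k)) ?sum_nat_const; last by move=> u _; apply: G_reg.
  by have -> : #|N v| = k by apply: G_reg.
(* Events indexed outside [D v] read only coordinates outside [N v]. *)
- move=> v S dS; apply: (determined_indep (X := N v)).
    exact: common_color_determined.
  move=> f g fg; rewrite !inE; apply: eq_forallb_in => w wS; congr negb.
  apply: common_color_determined => u wu; apply: fg; rewrite in_setC.
  have : w \notin D v.
    by apply: contraL dS => wD; apply/pred0Pn; exists w; apply/andP.
  rewrite inE negbK => /disjointFl ->//.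
- move=> v; have lk : (0 < l.+1 ^ k)%N by rewrite expn_gt0.
  rewrite -(leq_pmul2r lk) -mulnA.
  apply: leq_trans (leq_mul (leqnn _) (card_common_color v)) _.
  by rewrite mulnA [leqRHS]mulnC leq_mul2r large orbT.
- by rewrite card_ffun card_ord expn_gt0.
Qed.

Lemma dynamic_from_sublists : choosable G s ->
  exists2 c : G -> nat, dynamic_coloring c & forall v, c v \in L v.
Proof.
move=> Gs; have [r rP] := exists_no_common_color.
have [v|c c_proper cL] := Gs (fun v => sublist s (L v) (r v)).
  exact: card_sublist.
exists c => [|v]; last exact: sublist_sub (cL v).
split=> // v _.
have [u vu] : exists u, adj v u.
  by move: k_gt0; rewrite -(G_reg v) => /card_gt0P[u]; rewrite inE; exists u.
have [/existsP[w /andP[vw /eqP cuw]]|/existsPn cst] :=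
  boolP [exists w, adj v w && (c u != c w)]; first by exists u, w.
case/negP: (rP v); apply: (common_colorP (a := c u)) => w vw.
by have := cst w; rewrite vw negbK => /eqP ->.
Qed.

End DynamicFromSublists.

(** * Relations between the notions of colorability *)

Lemma choosable_dynamic (G : sgraph) (k l s : nat) : regular G k ->
  (0 < k)%N -> (s <= l)%N -> (4 * k ^ 2 * (l * s ^ k) <= l ^ k)%N ->
  choosable G s -> dynamic_choosable G l.
Proof.
move=> G_reg k_gt0 lesl large Gs L L_list.
(* If [l = 0] then [s = 0], and a choice from empty lists forces [G] to have no vertices. *)
case: l => [|l] in lesl large L_list *.
  case: s Gs lesl large => // Gs _ _; have [c _ cL] := Gs L L_list.
  exists c => //.
  by split=> [v w _|v]; have := cL v; rewrite (cardfs0_eq (L_list v)).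
exact: (dynamic_from_sublists G_reg L_list lesl k_gt0 large Gs).
Qed.

Lemma choosable_greedy (G : sgraph) k : regular G k -> choosable G k.+1.
Proof.
move=> G_reg L L_list.
suff [c cP cL] : exists2 c : G -> nat,
    {in enum G &, forall u v, adj u v -> c u <> c v} &
    {in enum G, forall v, c v \in L v}.
  by exists c => [u v|v]; [apply: cP | apply: cL]; rewrite mem_enum.
elim: (enum G) => [|x s [c cP cL]]; first by exists (fun=> 0%N).
have [xs|xNs] := boolP (x \in s).
  have sE : x :: s =i s by move=> y; rewrite inE; case: eqP => // ->.
  by exists c => [y z|y]; rewrite !sE; [apply: cP | apply: cL].
(* Some neighbors may be uncolored so far, with arbitrary values of [c]; [A] still has at most [k]
   colors. *)
pose A := [fset a in map c (enum [set w | adj x w])]%fset.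
have /fset0Pn[a] : (L x `\` A)%fset != fset0.
  rewrite fsetD_eq0; apply/negP => /fsubset_leq_card; apply/negP.
  rewrite L_list -ltnNge ltnS card_fseq (leq_trans (size_undup _)) // size_map.
  by rewrite -cardE; have := G_reg x; rewrite /degree => ->.
rewrite in_fsetD in_fset => /andP[aNA aL].
have aN w : adj x w -> c w <> a.
  by move=> xw ca; rewrite -ca map_f ?mem_enum ?inE in aNA.
exists (fun y => if y == x then a else c y) => [y z|y]; rewrite !inE.
  case: (eqVneq y x) => [->|_] /=; case: (eqVneq z x) => [->|_] //= ys zs.
  - by rewrite adj_irrefl.
  - by move/aN => caz /esym.
  - by rewrite adj_sym => /aN.
  - exact: cP.
by case: eqP => [-> //|_] /=; apply: cL.
Qed.

(** Constant lists {0, ..., l-1} make a list coloring an ordinary one. *)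
Lemma dynamic_choosable_colorable (G : sgraph) l :
  dynamic_choosable G l -> dynamic_colorable G l.
Proof.
move=> Gl.
have [v|c [c_proper c_dyn] cL] := Gl (fun=> [fset a in iota 0 l]%fset).
  by rewrite card_fseq undup_id ?size_iota ?iota_uniq.
have ltl v : (c v < l)%N by have := cL v; rewrite in_fset mem_iota.
exists (fun v => Ordinal (ltl v)); split=> [u v uv [eqc]|v v2].
  exact: c_proper uv eqc.
have [u [w [vu vw neq]]] := c_dyn v v2.
by exists u, w; split=> // -[].
Qed.

(** * Exponential against cubic growth *)

Lemma natmul_le_expr1D (R : realType) (eps : R) n : 0 < eps ->
  n%:R * eps <= (1 + eps) ^+ n.
Proof.
(* Bernoulli's inequality, proved by induction. *)
move=> eps_gt0; suff: 1 + n%:R * eps <= (1 + eps) ^+ n by lra.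
elim: n => [|n IHn]; first by rewrite mul0r addr0 expr0.
rewrite exprS -natr1; have n0 : 0 <= n%:R :> R := ler0n _ _.
have := ler_wpM2l (ltW (addr_gt0 ltr01 eps_gt0)) IHn; nra.
Qed.

(** A fourth power beats a cube: with m the integer part of k/4, (1+eps)^k >= ((1+eps)^m)^4 >= (m
    eps)^4. *)
Lemma expr_ge_cubic (R : realType) (eps C : R) : 0 < eps -> 0 <= C ->
  exists2 K : nat, (0 < K)%N &
    forall k, (K <= k)%N -> C * k.+1%:R ^+ 3 <= (1 + eps) ^+ k.
Proof.
(* [M] ensures m eps^4 >= 512 C, where 512 = 8^3 comes from k+1 <= 8m. *)
move=> eps_gt0 C_ge0; set M := Num.truncn (C * 512 / eps ^+ 4).
exists (4 * M.+1)%N => // k leK; pose m := (k %/ 4)%N.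
have lek : (4 * m <= k)%N by rewrite /m; lia.
have k8 : (k.+1 <= 8 * m)%N by rewrite /m; lia.
have Mm : (M.+1 <= m)%N by rewrite /m; lia.
have e1 : 1 <= 1 + eps by rewrite lerDl ltW.
apply: le_trans (ler_weXn2l e1 lek); rewrite mulnC exprM.
have me : 0 <= m%:R * eps by rewrite mulr_ge0 ?ler0n ?ltW.
apply: le_trans (lerXn2r 4 _ _ (natmul_le_expr1D m eps_gt0)); rewrite ?nnegrE //;
  last by rewrite exprn_ge0 // addr_ge0 ?ltW.
apply: (@le_trans _ _ (C * (8 * m%:R) ^+ 3)).
  by rewrite ler_wpM2l // lerXn2r ?nnegrE ?mulr_ge0 // -natrM ler_nat.
have Cm : C * 512 <= m%:R * eps ^+ 4.
  rewrite -ler_pdivrMr ?exprn_gt0 //; apply: ltW.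
  by apply: lt_le_trans (truncnS_gt _) _; rewrite ler_nat.
have -> : C * (8 * m%:R) ^+ 3 = C * 512 * m%:R ^+ 3 by ring.
have -> : (m%:R * eps) ^+ 4 = m%:R * eps ^+ 4 * m%:R ^+ 3 by ring.
by rewrite ler_wpM2r // exprn_ge0.
Qed.

(** * Chromatic numbers and the final estimate *)

Lemma list_chromatic_choosable (G : sgraph) :
  choosable G (list_chromatic_number G).
Proof. by rewrite /list_chromatic_number; case: ex_minnP => s /asboolP. Qed.

Lemma list_chromatic_min (G : sgraph) l :
  choosable G l -> (list_chromatic_number G <= l)%N.
Proof.
move=> Gl; rewrite /list_chromatic_number.
by case: ex_minnP => s _; apply; apply/asboolP.
Qed.

Lemma dynamic_list_chromatic_min (G : sgraph) l :
  dynamic_choosable G l -> (dynamic_list_chromatic_number G <= l)%N.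
Proof.
move=> Gl; rewrite /dynamic_list_chromatic_number.
by case: ex_minnP => s _; apply; apply/asboolP.
Qed.

Lemma dynamic_chromatic_le_list (G : sgraph) :
  (dynamic_chromatic_number G <= dynamic_list_chromatic_number G)%N.
Proof.
rewrite /dynamic_list_chromatic_number; case: ex_minnP => l /asboolP Gl _.
rewrite /dynamic_chromatic_number; case: ex_minnP => n _; apply.
exact/asboolP/dynamic_choosable_colorable.
Qed.

Theorem theorem3 (R : realType) (eps : R) (eps_gt0 : 0 < eps) :
  exists K : nat, forall k : nat, (K <= k)%N ->
  forall G : sgraph, regular G k ->
    (dynamic_chromatic_number G <= dynamic_list_chromatic_number G)%N /\
    (dynamic_list_chromatic_number G)%:Z
      <= Num.ceil ((1 + eps) * (list_chromatic_number G)%:R).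
Proof.
(* The local lemma will require 4 k^2 l <= (1+eps)^k, where l <= (2+eps)(k+1). *)
have [|K K_gt0 K_large] := @expr_ge_cubic R eps (4 * (2 + eps)) eps_gt0.
  lra.
exists K => k leKk G G_reg; split; first exact: dynamic_chromatic_le_list.
have Gs := @list_chromatic_choosable G.
have := list_chromatic_min (choosable_greedy G_reg).
move: (list_chromatic_number G) Gs => s Gs lesk.
set x := (1 + eps) * s%:R.
have x_ge0 : 0 <= x by rewrite mulr_ge0 ?ler0n //; lra.
have [l lE] : exists l : nat, Num.ceil x = l%:Z.
  exists `|Num.ceil x|%N; rewrite gez0_abs // ceil_ge0; lra.
have /andP[ltx lex] := ceil_itv x; rewrite lE in ltx lex *.
rewrite intrD /= -!pmulrn in ltx lex.
have les : s%:R <= l%:R :> R.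
  by apply: le_trans lex; rewrite /x ler_peMl ?ler0n //; lra.
rewrite lez_nat; apply: dynamic_list_chromatic_min.
apply: (choosable_dynamic G_reg (leq_trans K_gt0 leKk) _ _ Gs).
  by rewrite -(ler_nat R).
rewrite -(ler_nat R) !(natrM, natrX).
(* Since x^k = (1+eps)^k s^k, the factor s^k then cancels from both sides. *)
have xl : x ^+ k <= l%:R ^+ k by rewrite lerXn2r ?nnegrE ?ler0n.
apply: le_trans xl; rewrite /x exprMn mulrA ler_wpM2r ?exprn_ge0 ?ler0n //.
apply: le_trans (K_large k leKk).
have sk : s%:R <= k.+1%:R :> R by rewrite ler_nat.
have k1 : k%:R + 1 = k.+1%:R :> R by rewrite natr1.
have k0 : 0 <= k%:R :> R := ler0n _ _.
(* Rounding up adds less than 1, so l < (1+eps)(k+1) + 1. *)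
have lk : l%:R <= (2 + eps) * k.+1%:R :> R by rewrite /x in ltx; nra.
have -> : 4 * (2 + eps) * k.+1%:R ^+ 3
    = (4 * k.+1%:R ^+ 2) * ((2 + eps) * k.+1%:R) by ring.
apply: ler_pM; rewrite ?mulr_ge0 ?exprn_ge0 ?ler0n //.
by rewrite ler_wpM2l ?ler0n // lerXn2r ?nnegrE ?ler0n // ler_nat.
Qed.
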